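(* Let $\delta\in(0,1)$ be far from the dyadic rationals, i.e. $d(\delta)>0$, and let $\omega$ be a doubling weight on $\mathbb{R}$. Then: (i) $H^1(\omega)=H^1_d(\omega)+H^1_\delta(\omega)$ with equivalent norms. (ii) For each $f\in L^1_{\mathrm{loc}}$, $M_\omega(f)$ is pointwise equivalent to $M_{d,\omega}(f)+M_{\delta,\omega}(f)$, with implicit constants independent of $f$.
   Context: Dyadic grids: $\mathcal{D}=\bigcup_{n\in\mathbb{Z}}\mathcal{D}_n$, where $\mathcal{D}_n=\{[k2^{-n},(k+1)2^{-n}) : k\in\mathbb{Z}\}$. For $\delta\in\mathbb{R}$, $\mathcal{D}^\delta=\bigcup_{n\in\mathbb{Z}}\mathcal{D}^\delta_n$, where $\mathcal{D}^\delta_n=\{I+\delta: I\in\mathcal{D}_n\}$ for $n\ge 0$; $\mathcal{D}^\delta_n=\{I+\delta+\sum_{j=n/2+1}^{0}2^{-2j} : I\in\mathcal{D}_n\}$ for $n<0$ even; and for $n<0$ odd, $\mathcal{D}_n^\delta$ is determined by nestedness, i.e. it consists of the left and right halves of the intervals of $\mathcal{D}^\delta_{n-1}$. Far from the dyadic rationals: $d(\delta):=\inf\{2^n|\delta-k/2^n| : n\in\mathbb{Z},\ n\ge 0,\ k\in\mathbb{Z}\}>0$. Doubling weight: a nonnegative locally integrable function $\omega$ on $\mathbb{R}$, not a.e. zero, such that for some $C>0$, $\omega(\widetilde Q)\le C\omega(Q)$ for all bounded intervals $Q$, where $\widetilde Q$ has the same midpoint as $Q$ and twice its length, and $\omega(E)=\int_E\omega$.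 Weighted Hardy spaces: an $H^1(\omega)$-atom is a function $a$ such that $\operatorname{supp}a\subset Q$ for some interval $Q\subset\mathbb{R}$, $\|a\|_{L^2(\omega)}\le\omega(Q)^{-1/2}$, and $\int a\,\omega\,dx=0$. An $H^1_d(\omega)$-atom (resp. $H^1_\delta(\omega)$-atom) satisfies the same conditions with in addition $Q\in\mathcal{D}$ (resp. $Q\in\mathcal{D}^\delta$). Each of the spaces $H^1(\omega)$, $H^1_d(\omega)$, $H^1_\delta(\omega)$ is the corresponding atomic space: all $f=\sum_j\lambda_ja_j$ (convergence in $L^1(\omega)$) with $a_j$ atoms of the given type and $\sum_j|\lambda_j|<\infty$, with norm the infimum of $\sum_j|\lambda_j|$ over such representations. The sum of two spaces carries the norm $\inf\{\|g\|_{H^1_d(\omega)}+\|h\|_{H^1_\delta(\omega)}: f=g+h\}$. Weighted maximal functions: $M_\omega(f)(x)=\sup_{Q\ni x}\frac1{\omega(Q)}\int_Q|f(y)|\omega(y)\,dy$ with supremum over all intervals $Q$ containing $x$; $M_{d,\omega}$ (resp. $M_{\delta,\omega}$) is the same with the supremum over intervals $I\ni x$ with $I\in\mathcal{D}$ (resp. $I\in\mathcal{D}^\delta$). Pointwise equivalence means each side is bounded at every point by a constant multiple of the other. *)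

(* Defs.v *)
From HB Require Import structures.
From mathcomp Require Import all_boot all_order all_algebra.
From mathcomp Require Import all_classical all_reals all_analysis.

Set Implicit Arguments.
Unset Strict Implicit.
Unset Printing Implicit Defensive.

Import Order.TTheory GRing.Theory Num.Theory.
Import numFieldNormedType.Exports.

Local Open Scope classical_set_scope.
Local Open Scope ring_scope.

Section DyadicGrids.
Context {R : realType}.

Definition dyadic_gen (n : int) : set (set R) :=
  [set I | exists k : int,
     I = `[(k%:~R * 2 ^ (- n)), ((k + 1)%:~R * 2 ^ (- n))[%classic].

Definition dyadic : set (set R) := \bigcup_(n in [set: int]) dyadic_gen n.

Definition translate (s : R) (I : set R) : set R := [set x + s | x in I].

Definition halves (G : set (set R)) : set (set R) :=
  [set J | exists a b : R, G `[a, b[%classic /\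
     (J = `[a, (a + b) / 2[%classic \/ J = `[(a + b) / 2, b[%classic)].

(* Generation n = - 2m; the sum of the 2^(-2j) for n/2 + 1 <= j <= 0 is
   reindexed by i = - j; here n/2 + 1 = - m + 1. *)
Definition shifted_gen_even (delta : R) (m : nat) : set (set R) :=
  translate (delta + \sum_(0 <= i < m) 2 ^+ (2 * i)) @`
    dyadic_gen (- (2 * m)%N%:Z).

(* [Negz k] is - (k + 1), which is even iff k is odd. For k even, the
   generation preceding - (k + 1) is - (k + 2). *)
Definition shifted_gen (delta : R) (n : int) : set (set R) :=
  match n with
  | Posz _ => translate delta @` dyadic_gen n
  | Negz k => if odd k then shifted_gen_even delta k.+1./2
              else halves (shifted_gen_even delta k.+2./2)
  end.

Definition shifted_dyadic (delta : R) : set (set R) :=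
  \bigcup_(n in [set: int]) shifted_gen delta n.

Definition dyadic_dist (delta : R) : R :=
  inf [set r | exists (n : nat) (k : int),
         r = 2 ^+ n * `|delta - k%:~R / 2 ^+ n|].

Definition far_from_dyadic (delta : R) : Prop := 0 < dyadic_dist delta.

(* The booleans say whether each endpoint belongs to the interval. *)
Definition bnd_itv (lc rc : bool) (a b : R) : set R :=
  [set` Interval (BSide lc a) (BSide (~~ rc) b)].

Definition bounded_intervals : set (set R) :=
  [set Q | exists (lc rc : bool) (a b : R), a < b /\ Q = bnd_itv lc rc a b].

End DyadicGrids.

Section Weights.
Context {R : realType}.
Local Open Scope ereal_scope.
Notation mu := (@lebesgue_measure R).

Definition wmeas (w : R -> R) (E : set R) : \bar R := \int[mu]_(x in E) (w x)%:E.

Definition doubling_weight (w : R -> R) : Prop :=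
  [/\ forall x, (0 <= w x)%R,
      locally_integrable [set: R] w,
      ~ {ae mu, forall x, w x = 0%R} &
      exists2 C : R, (0 < C)%R &
        forall (lc rc : bool) (c r : R), (0 < r)%R ->
          wmeas w (bnd_itv lc rc (c - 2 * r) (c + 2 * r)) <=
          C%:E * wmeas w (bnd_itv lc rc (c - r) (c + r))].

Definition L1w_norm (w f : R -> R) : \bar R :=
  \int[mu]_x (`|f x| * w x)%:E.

Definition L2w_norm (w f : R -> R) : \bar R :=
  (\int[mu]_x (`|f x| ^+ 2 * w x)%:E) `^ 2^-1.

(* Equality almost everywhere for the measure w dx. A doubling weight may vanish
   on a set of positive Lebesgue measure. *)
Definition ae_eqw (w f g : R -> R) : Prop :=
  {ae mu, forall x, w x != 0%R -> f x = g x}.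

Definition weighted_maximal (w : R -> R) (G : set (set R)) (f : R -> R)
    (x : R) : \bar R :=
  ereal_sup [set (wmeas w Q)^-1 * \int[mu]_(y in Q) (`|f y| * w y)%:E
            | Q in [set Q | G Q /\ Q x]].

End Weights.

(* The set G of admissible intervals Q is [bounded_intervals], [dyadic] or
   [shifted_dyadic delta]. *)
Section AtomicHardySpaces.
Context {R : realType}.
Local Open Scope ereal_scope.
Notation mu := (@lebesgue_measure R).

Definition atom (w : R -> R) (G : set (set R)) (a : R -> R) : Prop :=
  measurable_fun [set: R] a /\
  exists Q, [/\ G Q,
    [set x | a x != 0%R] `<=` Q,
    L2w_norm w a <= wmeas w Q `^ (- 2^-1) &
    \int[mu]_x (a x * w x)%:E = 0].

Definition atomic_rep (w : R -> R) (G : set (set R)) (f : R -> R)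
    (lam : nat -> R) (a : nat -> R -> R) : Prop :=
  [/\ forall j, atom w G (a j),
      \sum_(0 <= j <oo) `|lam j|%:E < +oo &
      L1w_norm w (fun x => f x - \sum_(0 <= j < n) lam j * a j x)%R
        @[n --> \oo] --> 0].

Definition H1 (w : R -> R) (G : set (set R)) : set (R -> R) :=
  [set f | measurable_fun [set: R] f /\
           exists lam a, atomic_rep w G f lam a].

Definition H1_norm (w : R -> R) (G : set (set R)) (f : R -> R) : \bar R :=
  ereal_inf [set s | exists lam a, atomic_rep w G f lam a /\
               s = \sum_(0 <= j <oo) `|lam j|%:E].

Definition H1_sum (w : R -> R) (G1 G2 : set (set R)) : set (R -> R) :=
  [set f | measurable_fun [set: R] f /\
     exists g h, [/\ H1 w G1 g, H1 w G2 h &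
                     ae_eqw w f (fun x => g x + h x)%R]].

Definition H1_sum_norm (w : R -> R) (G1 G2 : set (set R)) (f : R -> R) :
    \bar R :=
  ereal_inf [set s | exists g h, [/\ H1 w G1 g, H1 w G2 h,
                       ae_eqw w f (fun x => g x + h x)%R &
                       s = H1_norm w G1 g + H1_norm w G2 h]].

End AtomicHardySpaces.

(* Main.v *)
Require Import Defs.
From mathcomp Require Import all_boot all_order all_algebra.
From mathcomp Require Import all_classical all_reals all_analysis.
From mathcomp Require Import measurable_realfun ring lra zify.
Set Implicit Arguments.
Unset Strict Implicit.
Unset Printing Implicit Defensive.
Import Order.TTheory GRing.Theory Num.Theory.
Import numFieldNormedType.Exports.
Local Open Scope classical_set_scope.
Local Open Scope ring_scope.

(* At scale s the endpoints of the two grids are at distance at least c s from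
   each other, where c > 0 depends on d(delta): for s <= 1 this is the
   hypothesis on delta, and for s = 4^m the shift delta + (4^m - 1) / 3 lies
   between s / 4 and 3 s / 4. So an interval of length less than c s misses the
   endpoints of one of the grids, and every bounded interval Q lies in an
   interval I of one of the grids with |I| <= K |Q|, whence w(I) <= K' w(Q) by
   doubling. Averages over Q are then controlled by averages over I, and an atom
   on Q is a constant multiple of an atom on I. Given an atomic decomposition of
   f, the dyadic part of the sum converges in L^1(w) to some g, and f - g is the
   sum of the remaining part. *)

(** * Dyadic grids *)

(** If [b] leaves both the cell of [s Z] and the cell of [s Z + t] that contain [a], the right
    endpoints of these two cells lie in []a, b]], so they are less than [b - a] apart. Their
    difference is [t] minus a multiple of [s]. *)
Lemma two_grids_cover (R : realType) (s t a b : R) : 0 < s ->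
  (forall k : int, b - a <= `|t - k%:~R * s|) ->
  exists k : int,
    (k%:~R * s <= a /\ b < (k + 1)%:~R * s) \/
    (k%:~R * s + t <= a /\ b < (k + 1)%:~R * s + t).
Proof.
move=> s0 H.
have fl (x : R) : exists k : int, k%:~R * s <= x < (k + 1)%:~R * s.
  exists (Num.floor (x / s)).
  by rewrite -ler_pdivlMr // -ltr_pdivrMr // floor_le floorD1_gt.
have [k /andP[ka ak]] := fl a; have [l /andP[la al]] := fl (a - t).
have [bk|kb] := ltP b ((k + 1)%:~R * s); first by exists k; left.
have [bl|lb] := ltP b ((l + 1)%:~R * s + t).
  by exists l; right; split => //; rewrite -lerBrDr.
suff : `|t - (k - l)%:~R * s| < b - a by rewrite ltNge H.
rewrite !intrD in ak kb al lb *; rewrite !mulrDl in ak kb al lb *.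
rewrite intrN.
by rewrite ltr_norml; apply/andP; split; lra.
Qed.

Lemma translate_itvco (R : realType) (s a b : R) :
  translate s `[a, b[%classic = `[a + s, b + s[%classic.
Proof.
apply/seteqP; split => x /=.
  by move=> [y /=]; rewrite !in_itv /= => /andP[? ?] <-; apply/andP; split; lra.
rewrite !in_itv /= => /andP[? ?]; exists (x - s); last by rewrite subrK.
by rewrite /= in_itv /=; apply/andP; split; lra.
Qed.

Lemma shifted_dyadic_fine (R : realType) (delta : R) (n : nat) (k : int) :
  shifted_dyadic delta `[k%:~R / 2 ^+ n + delta,
                         (k + 1)%:~R / 2 ^+ n + delta[%classic.
Proof.
exists n%:Z => //=; exists `[k%:~R / 2 ^+ n, (k + 1)%:~R / 2 ^+ n[%classic.
  by exists k; rewrite -exprnN.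
by rewrite translate_itvco.
Qed.

Lemma shifted_dyadic_coarse (R : realType) (delta : R) (m : nat) (k : int) :
  let t := delta + \sum_(0 <= i < m.+1) 2 ^+ (2 * i) in
  shifted_dyadic delta `[k%:~R * 2 ^+ (2 * m.+1) + t,
                         (k + 1)%:~R * 2 ^+ (2 * m.+1) + t[%classic.
Proof.
(* [Negz (2 * m).+1] is [- 2 (m + 1)], an even negative generation. *)
move=> t; exists (Negz (2 * m).+1) => //=.
have -> : ~~ odd (2 * m) by lia.
have -> : ((2 * m)./2 = m)%N by lia.
exists `[k%:~R * 2 ^+ (2 * m.+1), (k + 1)%:~R * 2 ^+ (2 * m.+1)[%classic.
  by exists k; rewrite opprK.
by rewrite translate_itvco.
Qed.

Lemma dyadic_fine (R : realType) (n : nat) (k : int) :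
  dyadic (`[k%:~R / 2 ^+ n, (k + 1)%:~R / 2 ^+ n[%classic : set R).
Proof. by exists n%:Z => //=; exists k; rewrite -exprnN. Qed.

Lemma dyadic_coarse (R : realType) (n : nat) (k : int) :
  dyadic (`[k%:~R * 2 ^+ n, (k + 1)%:~R * 2 ^+ n[%classic : set R).
Proof. by exists (- n%:Z) => //=; exists k; rewrite opprK. Qed.

(** With [s = 4^(m+1) >= 4] the geometric sum is [(s - 1) / 3], so the shift lies between [s / 4]
    and [s / 2]. The multiples of [s] to its left are those with [k <= 0]; the others are at least
    [s]. *)
Lemma shift_dist_coarse (R : realType) (delta : R) (m : nat) (k : int) :
  0 < delta < 1 ->
  2 ^+ (2 * m.+1) / 4 <=
    `|delta + \sum_(0 <= i < m.+1) 2 ^+ (2 * i) - k%:~R * 2 ^+ (2 * m.+1)|.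
Proof.
move=> /andP[d0 d1].
have E n : 3 * \sum_(0 <= i < n) 2 ^+ (2 * i) = 2 ^+ (2 * n) - 1 :> R.
  elim: n => [|n IH]; first by rewrite big_nil /= mulr0 subrr.
  by rewrite big_nat_recr //= mulrDr IH mulnS exprD; ring.
have s4 : 4 <= 2 ^+ (2 * m.+1) :> R.
  rewrite mulnS exprD -[leLHS]mulr1.
  have -> : 2 ^+ 2 = 4 :> R by ring.
  by rewrite ler_pM2l // exprn_ege1 // ler1n.
have := E m.+1; move: s4; set s := 2 ^+ (2 * m.+1); set S := \sum_(_ <= i < _) _.
move=> s4 ES; have s0 : 0 < s by lra.
have [k0|k1] := leP k 0.
  have : k%:~R * s <= 0 by rewrite mulr_le0_ge0 ?(ltW s0) // lerz0.
  by move=> ?; apply: le_trans (ler_norm _); lra.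
have : s <= k%:~R * s by rewrite ler_peMl ?(ltW s0) // ler1z; lia.
by move=> ?; rewrite distrC; apply: le_trans (ler_norm _); lra.
Qed.

Lemma dyadic_dist_le (R : realType) (delta : R) (n : nat) (k : int) :
  dyadic_dist delta / 2 ^+ n <= `|delta - k%:~R / 2 ^+ n|.
Proof.
rewrite ler_pdivrMr ?exprn_gt0 // mulrC; apply: ge_inf; last by exists n, k.
by exists 0 => _ [i [j ->]]; rewrite mulr_ge0 // exprn_ge0.
Qed.

(* Long intervals are covered using the even negative generations alone, which
   only costs a factor of 2 in the constant. *)
Lemma dyadic_or_shifted_cover (R : realType) (delta : R) :
  0 < delta < 1 -> far_from_dyadic delta ->
  exists2 K : R, 0 < K & forall a b : R, a < b -> exists p q : R,
    [/\ p <= a, b < q, q - p <= K * (b - a) &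
        dyadic `[p, q[%classic \/ shifted_dyadic delta `[p, q[%classic].
Proof.
(* [dyadic_dist delta] is the separation constant at the scales [2^-n], and [1 / 4] the one at the
   scales [4^(m+1)]. *)
move=> d01 far; pose d := Num.min (dyadic_dist delta) (1 / 4).
have d0 : 0 < d by rewrite lt_min far; lra.
have dd : d <= dyadic_dist delta by rewrite ge_min lexx.
have d4 : d <= 1 / 4 by rewrite ge_min lexx orbT.
have p0 n : 0 < 2 ^+ n :> R by rewrite exprn_gt0.
have pow_gt (x : R) : exists n : nat, x < 2 ^+ n.
  by exists (Num.bound x); apply: upper_nthrootP.
exists (4 / d); first by rewrite divr_gt0.
move=> a b ab; have l0 : 0 < b - a by rewrite subr_gt0.
have [ld|dl] := ltP (b - a) d.
  (* The least such [n] satisfies [(b - a) 2^n < d], by minimality or, for [n = 0], by the case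
     assumption. So the endpoints at scale [2^-n] are far enough apart, while
     [2^-n <= (2 / d) (b - a)]. *)
  have exn : exists n, d <= (b - a) * 2 ^+ n.+1.
    have [n hn] := pow_gt (d / (b - a)); exists n.
    move: hn; rewrite ltr_pdivrMr // => hn.
    by rewrite exprS mulrCA mulrC; have := p0 n; nra.
  case: (ex_minnP exn) => n hn mn.
  have ln : (b - a) * 2 ^+ n < d.
    case: n hn mn => [|n] hn mn; first by rewrite expr0 mulr1.
    by rewrite ltNge; apply/negP => /mn; rewrite ltnn.
  have [|k|k H] := @two_grids_cover R (2 ^+ n)^-1 delta a b.
  - by rewrite invr_gt0.
  - apply: le_trans (dyadic_dist_le delta n k).
    by rewrite ler_pdivlMr //; lra.
  have sK : (2 ^+ n)^-1 <= 4 / d * (b - a).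
    rewrite mulrAC ler_pdivlMr // mulrC ler_pdivrMr //.
    by move: hn; rewrite exprS; have := p0 n; nra.
  case: H => [[ka bk]|[ka bk]].
    exists (k%:~R / 2 ^+ n), ((k + 1)%:~R / 2 ^+ n); split => //.
      by rewrite -mulrBl intrD addrAC subrr add0r mul1r.
    by left; exact: dyadic_fine.
  exists (k%:~R / 2 ^+ n + delta), ((k + 1)%:~R / 2 ^+ n + delta); split => //.
    by rewrite opprD addrACA subrr addr0 -mulrBl intrD addrAC subrr add0r mul1r.
  by right; exact: shifted_dyadic_fine.
(* The least such [m] satisfies [d 4^m <= b - a < d 4^(m+1)]. The left inequality is the source of
   the constant [4 / d]. *)
have exm : exists m, (b - a) < d * 2 ^+ (2 * m.+1).
  have [n hn] := pow_gt ((b - a) / d); exists n.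
  move: hn; rewrite ltr_pdivrMr // => hn.
  have : 2 ^+ n <= 2 ^+ (2 * n.+1) :> R by rewrite ler_eXn2l ?ltr1n //; lia.
  by nra.
case: (ex_minnP exm) => m hm mm.
have lm : d * 2 ^+ (2 * m) <= b - a.
  case: m hm mm => [|m] hm mm; first by rewrite mulr1.
  by rewrite leNgt; apply/negP => /mm; rewrite ltnn.
pose t := delta + \sum_(0 <= i < m.+1) 2 ^+ (2 * i).
have [//|k|k H] := @two_grids_cover R (2 ^+ (2 * m.+1)) t a b.
  apply: le_trans (shift_dist_coarse m k d01).
  by have := p0 (2 * m.+1)%N; nra.
have sK : 2 ^+ (2 * m.+1) <= 4 / d * (b - a).
  rewrite mulrAC ler_pdivlMr // mulnS exprD.
  have -> : 2 ^+ 2 = 4 :> R by ring.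
  by have := p0 (2 * m)%N; nra.
case: H => [[ka bk]|[ka bk]].
  exists (k%:~R * 2 ^+ (2 * m.+1)), ((k + 1)%:~R * 2 ^+ (2 * m.+1)); split => //.
    by rewrite -mulrBl intrD addrAC subrr add0r mul1r.
  by left; exact: dyadic_coarse.
exists (k%:~R * 2 ^+ (2 * m.+1) + t), ((k + 1)%:~R * 2 ^+ (2 * m.+1) + t).
split => //.
  by rewrite opprD addrACA subrr addr0 -mulrBl intrD addrAC subrr add0r mul1r.
by right; exact: shifted_dyadic_coarse.
Qed.

Lemma dyadic_bounded (R : realType) :
  (dyadic : set (set R)) `<=` bounded_intervals.
Proof.
move=> _ [n _ [k ->]]; exists true, false, (k%:~R * 2 ^ (- n)).
exists ((k + 1)%:~R * 2 ^ (- n)); split => //.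
by rewrite ltr_pM2r ?exprz_gt0 // ltr_int; lia.
Qed.

Lemma translate_bounded (R : realType) (s : R) (n : int) :
  translate s @` dyadic_gen n `<=`
    [set I | exists a b : R, a < b /\ I = `[a, b[%classic].
Proof.
move=> _ [_ [k ->] <-]; exists (k%:~R * 2 ^ (- n) + s).
exists ((k + 1)%:~R * 2 ^ (- n) + s); rewrite translate_itvco; split => //.
by rewrite ltrD2r ltr_pM2r ?exprz_gt0 // ltr_int; lia.
Qed.

Lemma shifted_dyadic_bounded (R : realType) (delta : R) :
  shifted_dyadic delta `<=` bounded_intervals.
Proof.
have co : [set I | exists a b : R, a < b /\ I = `[a, b[%classic] `<=` bounded_intervals.
  by move=> _ [a [b [ab ->]]]; exists true, false, a, b.
move=> J [[n|n] _ /=]; first by move/translate_bounded; exact: co.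
case: ifP => _; first by move/translate_bounded; exact: co.
move=> [a [b [/translate_bounded[c [d [cd E]]] H]]]; apply: co.
(* The parent [[a, b[] is only known to equal, as a set, some [[c, d[] with [c < d]; it contains
   [c], hence is not empty. *)
have ab : a < b.
  have : `[a, b[%classic c by rewrite E /= in_itv /= lexx.
  by rewrite /= in_itv /= => /andP[]; exact: le_lt_trans.
by case: H => ->; [exists a, ((a + b) / 2) | exists ((a + b) / 2), b];
  split => //; lra.
Qed.

(** * Doubling weights and maximal functions *)

Lemma bounded_interval_measurable (R : realType) (Q : set R) :
  bounded_intervals Q -> measurable Q.
Proof. by move=> [lc [rc [a [b [_ ->]]]]]; exact: measurable_itv. Qed.

Lemma bnd_itv_sub_cc (R : realType) lc rc (a b : R) :
  bnd_itv lc rc a b `<=` `[a, b]%classic.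
Proof.
by move=> x; case: lc rc => [] []; rewrite /bnd_itv /= !in_itv /= => /andP[? ?];
  apply/andP; split => //; apply/ltW.
Qed.

Lemma oo_sub_bnd_itv (R : realType) lc rc (a b : R) :
  `]a, b[%classic `<=` bnd_itv lc rc a b.
Proof.
by move=> x; case: lc rc => [] []; rewrite /bnd_itv /= !in_itv /= => /andP[? ?];
  apply/andP; split => //; apply/ltW.
Qed.

Section DoublingWeight.
Context {R : realType} (w : R -> R) (dw : doubling_weight w).
Local Open Scope ereal_scope.
Notation mu := (@lebesgue_measure R).

Let w0 x : (0 <= w x)%R. Proof. by case: dw => w0 _ _ _; exact: w0. Qed.

Lemma doubling_measurable : measurable_fun [set: R] w.
Proof. by case: dw => _ []. Qed.

Lemma wmeas_ge0 (E : set R) : 0 <= wmeas w E.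
Proof. by apply: integral_ge0 => x _; rewrite lee_fin. Qed.

Lemma wmeas_le (E F : set R) : measurable E -> measurable F -> E `<=` F ->
  wmeas w E <= wmeas w F.
Proof.
move=> mE mF EF; apply: ge0_subset_integral => //.
- by apply/measurable_EFinP; apply: measurable_funTS; exact: doubling_measurable.
- by move=> x _; rewrite lee_fin.
Qed.

Lemma wmeas_lty (Q : set R) : bounded_intervals Q -> wmeas w Q < +oo.
Proof.
move=> bQ; have mQ := bounded_interval_measurable bQ.
case: bQ mQ => [lc [rc [a [b [ab ->]]]]] mQ.
(* Local integrability speaks of compact sets, hence the passage to the closed interval. *)
apply: (@le_lt_trans _ _ (wmeas w `[a, b]%classic)).
  by apply: wmeas_le => //; exact: bnd_itv_sub_cc.
case: dw => _ [_ _ /(_ `[a, b]%classic)] + _ _.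
move=> /(_ (fun _ _ => I) (@segment_compact R a b)).
by under eq_integral do rewrite ger0_norm //.
Qed.

Lemma doubling_iter : exists2 C : R, (0 < C)%R &
  forall (n : nat) (lc rc : bool) (c r : R), (0 < r)%R ->
    wmeas w (bnd_itv lc rc (c - 2 ^+ n * r) (c + 2 ^+ n * r)) <=
    (C ^+ n)%:E * wmeas w (bnd_itv lc rc (c - r) (c + r)).
Proof.
case: dw => _ _ _ [C C0 H]; exists C => // n lc rc c r r0.
elim: n => [|n IH]; first by rewrite !expr0 !mul1r mul1e.
rewrite !exprS -!mulrA EFinM -muleA.
apply: le_trans (H _ _ _ _ _) _; first by rewrite mulr_gt0 ?exprn_gt0.
by rewrite lee_wpmul2l // lee_fin ltW.
Qed.

(** If [Q] had weight 0, doubling would give weight 0 to all its dilates by [2^n]. These exhaust the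
    line, so [w] would vanish almost everywhere. *)
Lemma wmeas_gt0 (Q : set R) : bounded_intervals Q -> 0 < wmeas w Q.
Proof.
move=> [lc [rc [a [b [ab ->]]]]].
rewrite lt_neqAle wmeas_ge0 andbT eq_sym; apply/eqP => Q0.
case: dw => _ _ + _; apply.
have [C C0 H] := doubling_iter.
pose c := ((a + b) / 2)%R; pose r := ((b - a) / 2)%R.
have r0 : (0 < r)%R by rewrite /r; lra.
pose Qn (n : nat) := bnd_itv lc rc (c - 2 ^+ n * r) (c + 2 ^+ n * r).
have mQ n : measurable (Qn n) by exact: measurable_itv.
have Hn n : wmeas w (Qn n) = 0.
  apply/eqP; rewrite eq_le wmeas_ge0 andbT.
  apply: le_trans (H n lc rc c r r0) _.
  have -> : (c - r = a)%R by rewrite /c /r; lra.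
  have -> : (c + r = b)%R by rewrite /c /r; lra.
  by rewrite Q0 mule0.
have Qae n : {ae mu, forall x, Qn n x -> w x = 0%R}.
  have mw : measurable_fun (Qn n) (EFin \o w).
    by apply/measurable_EFinP; apply: measurable_funTS; exact: doubling_measurable.
  have [+ _] := ae_eq_integral_abs mu (mQ n) mw.
  have -> : \int[mu]_(x in Qn n) `|(EFin \o w) x| = 0.
    by rewrite -{}[RHS](Hn n); apply: eq_integral => x _ /=; rewrite ger0_norm.
  by move=> /(_ erefl); apply: filterS => x /= H0 /H0 [].
have := ae_foralln Qae; apply: filterS => x /= Hx.
pose n := Num.bound (`|(x : R) - c| / r)%R.
have := upper_nthrootP (leqnn n); rewrite ltr_pdivrMr // => xn.
apply: (Hx n); apply: oo_sub_bnd_itv; rewrite /= in_itv /=.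
by move: xn; rewrite ltr_norml => /andP[? ?]; apply/andP; split; lra.
Qed.

Lemma wmeas_fin_num (Q : set R) : bounded_intervals Q -> wmeas w Q \is a fin_num.
Proof. by move=> bQ; rewrite ge0_fin_numE ?wmeas_ge0 ?wmeas_lty. Qed.

(** The grid interval that covers [Q] has length comparable to that of [Q], so it lies in a fixed
    dilate of [Q], whose weight is controlled by iterated doubling. *)
Lemma dyadic_or_shifted_superset (delta : R) :
  (0 < delta < 1)%R -> far_from_dyadic delta ->
  exists2 K : R, (0 < K)%R & forall Q, bounded_intervals Q -> exists I : set R,
    [/\ Q `<=` I, dyadic I \/ shifted_dyadic delta I &
        wmeas w I <= K%:E * wmeas w Q].
Proof.
move=> d01 far; have [K K0 cover] := dyadic_or_shifted_cover d01 far.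
have [C C0 iter] := doubling_iter.
(* With [r] half the length of [Q], the length of [I] is at most [2 K r < 2^n r]. Since [I] contains
   the midpoint of [Q], it lies in the dilate of [Q] by [2^n]. *)
pose n := Num.bound (2 * K)%R; exists (C ^+ n)%R; first by rewrite exprn_gt0.
move=> _ [lc [rc [a [b [ab ->]]]]].
have [p [q [pa bq qp I]]] := cover a b ab.
exists `[p, q[%classic; split => //.
  move=> x /bnd_itv_sub_cc; rewrite /= !in_itv /= => /andP[ax xb].
  by rewrite (le_trans pa ax) (le_lt_trans xb bq).
pose c := ((a + b) / 2)%R; pose r := ((b - a) / 2)%R.
have r0 : (0 < r)%R by rewrite /r; lra.
have cra : (c - r = a)%R by rewrite /c /r; lra.
have crb : (c + r = b)%R by rewrite /c /r; lra.
have := iter n lc rc c r r0; rewrite cra crb; apply: le_trans.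
have Kn : (2 * K < 2 ^+ n)%R by apply: upper_nthrootP.
have qpn : (q - p < 2 ^+ n * r)%R.
  by apply: le_lt_trans qp _; rewrite /r; nra.
apply: wmeas_le; [exact: measurable_itv|exact: measurable_itv|].
move=> x; rewrite /= in_itv /= => /andP[px xq]; apply: oo_sub_bnd_itv.
by rewrite /= in_itv /=; apply/andP; split; lra.
Qed.

Lemma weighted_average_le (Q I : set R) (K : R) (f : R -> R) :
  measurable_fun [set: R] f -> bounded_intervals Q -> bounded_intervals I ->
  Q `<=` I -> wmeas w I <= K%:E * wmeas w Q ->
  (wmeas w Q)^-1 * \int[mu]_(y in Q) (`|f y| * w y)%:E <=
  K%:E * ((wmeas w I)^-1 * \int[mu]_(y in I) (`|f y| * w y)%:E).
Proof.
move=> mf bQ bI QI IQ.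
have mQ := bounded_interval_measurable bQ.
have mI := bounded_interval_measurable bI.
(* Positive finite weights turn the inverses in the extended reals into ordinary ones. *)
have fin0 (J : set R) : bounded_intervals J ->
    exists2 r : R, (0 < r)%R & wmeas w J = r%:E.
  move=> bJ; exists (fine (wmeas w J)); last by rewrite fineK ?wmeas_fin_num.
  by rewrite fine_gt0 // wmeas_gt0 //= wmeas_lty.
move: IQ; have [wQ wQ0 ->] := fin0 Q bQ; have [wI wI0 ->] := fin0 I bI.
rewrite -EFinM lee_fin => IQ; rewrite !inver !gt_eqF // muleA -EFinM.
have le_int : \int[mu]_(y in Q) (`|f y| * w y)%:E <=
              \int[mu]_(y in I) (`|f y| * w y)%:E.
  apply: ge0_subset_integral => //.
    apply/measurable_EFinP; apply: measurable_funTS; apply: measurable_funM.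
      exact: measurableT_comp.
    exact: doubling_measurable.
  by move=> x _; rewrite lee_fin mulr_ge0.
apply: lee_pmul => //.
- by rewrite lee_fin invr_ge0 ltW.
- by apply: integral_ge0 => x _; rewrite lee_fin mulr_ge0.
- by rewrite lee_fin -[leLHS]mul1r ler_pdivrMr // mulrAC ler_pdivlMr // mul1r.
Qed.

(** * Comparison of the maximal functions *)

Lemma maximal_le (G1 G2 : set (set R)) (f : R -> R) (x : R) :
  G1 `<=` G2 -> weighted_maximal w G1 f x <= weighted_maximal w G2 f x.
Proof.
move=> G12; apply: ereal_sup_le => _ [Q [GQ Qx] <-].
by exists Q => //; split => //; exact: G12.
Qed.

(** A supremum over no interval would be [-oo]; the witness [I] excludes this. *)
Lemma maximal_ge0 (G : set (set R)) (f : R -> R) (x : R) (I : set R) :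
  I x -> G I -> 0 <= weighted_maximal w G f x.
Proof.
move=> Ix GI; apply: le_ereal_sup_tmp; eexists; first by exists I.
rewrite mule_ge0 ?inve_ge0 ?wmeas_ge0 //.
by apply: integral_ge0 => y _; rewrite lee_fin mulr_ge0.
Qed.

Lemma maximal_equivalence (delta : R) :
  (0 < delta < 1)%R -> far_from_dyadic delta ->
  exists2 C : R, (0 < C)%R &
     forall f : R -> R, measurable_fun [set: R] f ->
       forall x : R,
         weighted_maximal w bounded_intervals f x <=
            C%:E * (weighted_maximal w dyadic f x +
                    weighted_maximal w (shifted_dyadic delta) f x) /\
         weighted_maximal w dyadic f x +
          weighted_maximal w (shifted_dyadic delta) f x <=
            C%:E * weighted_maximal w bounded_intervals f x.
Proof.
move=> d01 far; have [K K0 cover] := dyadic_or_shifted_superset d01 far.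
(* [K] comes from replacing [Q] by a grid interval; 2 comes from adding two maximal functions, each
   at most the full one. *)
exists (Num.max K 2)%R; first by rewrite lt_max K0.
move=> f mf x.
have dx : weighted_maximal w dyadic f x <= weighted_maximal w bounded_intervals f x.
  by apply: maximal_le; exact: dyadic_bounded.
have sx : weighted_maximal w (shifted_dyadic delta) f x <=
    weighted_maximal w bounded_intervals f x.
  by apply: maximal_le; exact: shifted_dyadic_bounded.
have d0 : 0 <= weighted_maximal w dyadic f x.
  have := dyadic_fine R 0 (Num.floor x); rewrite expr0 !divr1.
  by apply: maximal_ge0; rewrite /= in_itv /= floor_le floorD1_gt.
have s0 : 0 <= weighted_maximal w (shifted_dyadic delta) f x.
  have := shifted_dyadic_fine delta 0 (Num.floor (x - delta)).
  rewrite expr0 !divr1; apply: maximal_ge0.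
  by rewrite /= in_itv /= -lerBrDr -ltrBlDr floor_le floorD1_gt.
split; last first.
  apply: (@le_trans _ _ (2%R%:E * weighted_maximal w bounded_intervals f x)).
    by rewrite (_ : 2%R%:E = 1 + 1) // ge0_muleDl // !mul1e leeD.
  by apply: lee_wpmul2r; [exact: le_trans dx|rewrite lee_fin le_max lexx orbT].
apply: (@le_trans _ _ (K%:E * (weighted_maximal w dyadic f x +
                    weighted_maximal w (shifted_dyadic delta) f x))); last first.
  by apply: lee_wpmul2r; [exact: adde_ge0|rewrite lee_fin le_max lexx].
apply: ge_ereal_sup => _ [Q [bQ Qx] <-].
have [I [QI GI wI]] := cover Q bQ.
have bI : bounded_intervals I.
  by case: GI; [exact: dyadic_bounded|exact: shifted_dyadic_bounded].
apply: le_trans (weighted_average_le mf bQ bI QI wI) _.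
apply: lee_wpmul2l; first by rewrite lee_fin ltW.
have avg G : G I -> (wmeas w I)^-1 * \int[mu]_(y in I) (`|f y| * w y)%:E <=
    weighted_maximal w G f x.
  by move=> GI'; apply: ereal_sup_ubound; exists I => //; split => //; exact: QI.
case: GI => /avg; move/le_trans; apply; first exact: leeDl.
exact: leeDr.
Qed.

End DoublingWeight.

(** * Series in weighted L1 *)

(** Removes the square roots from the normalisation of an atom, which becomes a bound by [1 / w(Q)]
    on the integral of [|a|^2 w]. *)
Lemma poweR_half_le (R : realType) (x : \bar R) (r : R) : (0 <= x)%E -> 0 < r ->
  (x `^ 2^-1 <= r%:E `^ (- 2^-1))%E = (x <= r^-1%:E)%E.
Proof.
move=> x0 r0; case: x x0 => [s| |] // s0.
  rewrite !poweR_EFin !lee_fin powRN !powR12_sqrt ?(ltW r0) //.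
  by rewrite -sqrtrV ?(ltW r0) // ler_sqrt // invr_ge0 ltW.
by rewrite poweRyr // poweR_EFin !leye_eq.
Qed.

(** Finiteness of the two infima provides elements within [e / 2] of each. *)
Lemma ereal_infD_ge (R : realType) (S1 S2 : set \bar R) (x : \bar R) :
  ereal_inf S1 \is a fin_num -> ereal_inf S2 \is a fin_num ->
  (forall s1 s2, S1 s1 -> S2 s2 -> x <= s1 + s2)%E ->
  (x <= ereal_inf S1 + ereal_inf S2)%E.
Proof.
move=> f1 f2 H; apply/lee_addgt0Pr => e e0.
have e20 : 0 < e / 2 by rewrite divr_gt0.
have [s1 S1s1 ls1] := lb_ereal_inf_adherent e20 f1.
have [s2 S2s2 ls2] := lb_ereal_inf_adherent e20 f2.
apply: le_trans (H _ _ S1s1 S2s2) _.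
have -> : e%:E = ((e / 2)%:E + (e / 2)%:E)%E by rewrite -EFinD -splitr.
by rewrite addeACA leeD // ltW.
Qed.

(** Used to merge two atomic series into one: [u] occupies the even positions and [v] the odd
    ones. *)
Lemma sum_interleave (V : nmodType) (u v : nat -> V) (n : nat) :
  \sum_(0 <= j < n) (if odd j then v j./2 else u j./2) =
  \sum_(0 <= j < uphalf n) u j + \sum_(0 <= j < n./2) v j.
Proof.
elim: n => [|n IH]; first by rewrite !big_nil addr0.
rewrite big_nat_recr //= {}IH uphalf_half.
case: (odd n) => /=.
  by rewrite add1n -addrA; congr (_ + _); rewrite [RHS]big_nat_recr.
by rewrite add0n [in RHS]big_nat_recr //= addrAC.
Qed.

Lemma maxr_posnegB (R : realFieldType) (x : R) :
  Num.max x 0 - Num.max (- x) 0 = x.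
Proof. by case: (leP x 0); case: (leP (- x) 0); lra. Qed.

Lemma maxr_posnegD (R : realFieldType) (x : R) :
  Num.max x 0 + Num.max (- x) 0 = `|x|.
Proof. by case: (leP x 0); case: (leP (- x) 0); case: (ler0P x); lra. Qed.

Section WeightedL1.
Context {R : realType} (w : R -> R).
Context (w0 : forall x, 0 <= w x) (mw : measurable_fun [set: R] w).
Local Open Scope ereal_scope.
Notation mu := (@lebesgue_measure R).

Lemma L1w_measurable (f : R -> R) : measurable_fun [set: R] f ->
  measurable_fun [set: R] (fun x => (`|f x| * w x)%:E).
Proof.
move=> mf; apply/measurable_EFinP; apply: measurable_funM => //.
exact: measurableT_comp.
Qed.

Lemma L1w_norm_ge0 (f : R -> R) : 0 <= L1w_norm w f.
Proof. by apply: integral_ge0 => x _; rewrite lee_fin mulr_ge0. Qed.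

Lemma L1w_triangle (f g h : R -> R) : measurable_fun [set: R] f ->
  measurable_fun [set: R] g -> measurable_fun [set: R] h ->
  ae_eqw w f (fun x => g x + h x)%R ->
  L1w_norm w f <= L1w_norm w g + L1w_norm w h.
Proof.
move=> mf mg mh E.
have p0 (u : R -> R) x : [set: R] x -> 0 <= (`|u x| * w x)%:E.
  by move=> _; rewrite lee_fin mulr_ge0.
rewrite /L1w_norm -ge0_integralD //; try exact: p0; try exact: L1w_measurable.
apply: ae_ge0_le_integral => //; try exact: p0; try exact: L1w_measurable.
- by move=> x _; rewrite adde_ge0 ?p0.
- by apply: emeasurable_funD; exact: L1w_measurable.
move: E; apply: (@filterS _ _ (ae_filter_ringOfSetsType mu)) => x /= E _.
rewrite -EFinD lee_fin.
(* Where [w] vanishes the functions need not agree, but both sides are 0. *)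
have [->|wx] := eqVneq (w x) 0%R; first by rewrite !mulr0 addr0.
by rewrite E // -mulrDl ler_wpM2r // ler_normD.
Qed.

Lemma L1w_normZ (c : R) (f : R -> R) : measurable_fun [set: R] f ->
  L1w_norm w (fun x => c * f x)%R = `|c|%:E * L1w_norm w f.
Proof.
move=> mf; rewrite /L1w_norm -ge0_integralZl //.
- by apply: eq_integral => x _; rewrite normrM -mulrA EFinM.
- exact: L1w_measurable.
- by move=> x _; rewrite lee_fin mulr_ge0.
Qed.

Lemma L1w_cvg0_le (u : nat -> R -> R) (s : nat -> \bar R) :
  (forall n, L1w_norm w (u n) <= s n) -> s n @[n --> \oo] --> 0 ->
  L1w_norm w (u n) @[n --> \oo] --> 0.
Proof.
move=> us s0; apply: squeeze_cvge s0 => //; last exact: cvg_cst.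
by apply: nearW => n; rewrite L1w_norm_ge0 us.
Qed.

(** The difference is the tail of the positive parts minus the tail of the negative parts. Both are
    nonnegative and add up to the tail of the absolute values. *)
Lemma nneseries_posneg_tail (u : nat -> R) (n : nat) :
  \sum_(0 <= j <oo) `|u j|%:E < +oo ->
  (`|fine (\sum_(0 <= j <oo) (Num.max (u j) 0)%:E)
     - fine (\sum_(0 <= j <oo) (Num.max (- u j) 0)%:E)
     - \sum_(0 <= j < n) u j|%R)%:E <= \sum_(0 <= j <oo) `|u (j + n)%N|%:E.
Proof.
move=> uoo.
have m0 (v : nat -> R) j : (0 : \bar R) <= (Num.max (v j) 0)%:E.
  by rewrite lee_fin le_max lexx orbT.
have tail_le k : \sum_(k <= j <oo) `|u j|%:E <= \sum_(0 <= j <oo) `|u j|%:E.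
  by rewrite (nneseries_split 0 k) // add0n leeDr // sume_ge0.
have tail_fin (v : nat -> R) k : (forall j, Num.max (v j) 0 <= `|u j|)%R ->
    (\sum_(k <= j <oo) (Num.max (v j) 0)%:E) \is a fin_num.
  move=> vu; rewrite ge0_fin_numE; last exact: nneseries_ge0.
  apply: le_lt_trans uoo; apply: le_trans (tail_le k).
  by apply: lee_nneseries => [j _ _|j _]; [exact: m0|rewrite lee_fin vu].
have Pu j : (Num.max (u j) 0 <= `|u j|)%R by rewrite ge_max ler_norm normr_ge0.
have Nu j : (Num.max (- u j) 0 <= `|u j|)%R.
  by rewrite ge_max -normrN ler_norm normr_ge0.
rewrite (nneseries_split 0 n (fun j _ => m0 u j)).
rewrite (nneseries_split 0 n (fun j _ => m0 (fun i => - u i)%R j)).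
rewrite !add0n !sumEFin !fineD ?tail_fin //=.
have -> : \sum_(0 <= j <oo) `|u (j + n)%N|%:E =
    \sum_(n <= j <oo) (Num.max (u j) 0)%:E + \sum_(n <= j <oo) (Num.max (- u j) 0)%:E.
  rewrite (nneseries_addn (f := fun j => `|u j|%:E)) // -nneseriesD;
    [|by move=> i _ _; exact: m0|by move=> i _ _; exact: (m0 (fun j => - u j)%R)].
  apply: eq_eseriesr => j _; rewrite -EFinD; congr (_%:E).
  by rewrite maxr_posnegD.
set p := \sum_(n <= j <oo) (Num.max (u j) 0)%:E.
set q := \sum_(n <= j <oo) (Num.max (- u j) 0)%:E.
have -> : p + q = (fine p + fine q)%:E by rewrite EFinD !fineK ?tail_fin.
have p0 : (0 <= fine p)%R by apply: fine_ge0; apply: nneseries_ge0 => j _ _; exact: m0.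
have q0 : (0 <= fine q)%R.
  by apply: fine_ge0; apply: nneseries_ge0 => j _ _; exact: (m0 (fun i => - u i)%R).
have -> : (\sum_(0 <= j < n) u j = \sum_(0 <= j < n) Num.max (u j) 0 -
    \sum_(0 <= j < n) Num.max (- u j) 0)%R.
  rewrite -sumrB; apply: eq_bigr => j _.
  by rewrite maxr_posnegB.
by rewrite lee_fin ler_norml; apply/andP; split; lra.
Qed.

(* Where the series diverges, [fine] turns the infinite sums of positive or
   negative parts into 0; this happens only on a set of w-measure 0. *)
Lemma L1w_series_complete (u : nat -> R -> R) :
  (forall n, measurable_fun [set: R] (u n)) ->
  \sum_(0 <= n <oo) L1w_norm w (u n) < +oo ->
  exists2 g : R -> R, measurable_fun [set: R] g &
    L1w_norm w (fun x => g x - \sum_(0 <= j < n) u j x)%R @[n --> \oo] --> 0.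
Proof.
move=> mu_ uoo.
have mpart (v : nat -> R -> R) : (forall n, measurable_fun [set: R] (v n)) ->
    measurable_fun [set: R] (fun x => fine (\sum_(0 <= j <oo) (Num.max (v j x) 0)%:E)).
  move=> mv; apply: (measurableT_comp (fine_measurable measurableT)).
  apply: ge0_emeasurable_sum => [k x _ _|k _].
    by rewrite lee_fin le_max lexx orbT.
  by apply/measurable_EFinP; apply: measurable_maxr.
exists (fun x => fine (\sum_(0 <= j <oo) (Num.max (u j x) 0)%:E) -
          fine (\sum_(0 <= j <oo) (Num.max (- u j x) 0)%:E))%R.
  apply: measurable_funB; first exact: mpart.
  by apply: mpart => n; exact: measurableT_comp.
(* The error after [n] terms is bounded by a tail of the convergent series of norms. *)
apply: (L1w_cvg0_le (s := fun n => \sum_(n <= j <oo) L1w_norm w (u j))); last first.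
  by apply: nneseries_tail_cvg => // k _; exact: L1w_norm_ge0.
move=> n; set g := (g in fun x => (g x - _)%R).
have mg : measurable_fun [set: R] g.
  apply: measurable_funB; first exact: mpart.
  by apply: mpart => j; exact: measurableT_comp.
have mS : measurable_fun [set: R] (fun x => \sum_(0 <= j < n) u j x)%R.
  exact: measurable_sum.
rewrite -(nneseries_addn (f := fun j => L1w_norm w (u j)));
  last exact: (fun=> L1w_norm_ge0 _).
have term0 (v : R -> R) x : 0 <= (`|v x| * w x)%:E by rewrite lee_fin mulr_ge0.
rewrite -integral_nneseries //; last by move=> j; exact: L1w_measurable.
have mF (v : nat -> R -> R) : (forall n, measurable_fun [set: R] (v n)) ->
    measurable_fun [set: R] (fun x => \sum_(0 <= j <oo) (`|v j x| * w x)%:E).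
  move=> mv; apply: ge0_emeasurable_sum => [k x _ _ //|k _].
  exact: L1w_measurable.
apply: ae_ge0_le_integral => //.
- by move=> x _; rewrite lee_fin mulr_ge0.
- by apply: L1w_measurable; exact: measurable_funB.
- by move=> x _; apply: nneseries_ge0 => j _ _; rewrite lee_fin mulr_ge0.
- exact: (mF (fun j => u (j + n)%N)).
pose F x := \sum_(0 <= j <oo) (`|u j x| * w x)%:E.
have F0 x : 0 <= F x by exact: nneseries_ge0.
(* Exchanging sum and integral of nonnegative terms, the integral of [F] is the sum of the norms;
   hence [F] is finite almost everywhere. *)
have intF : mu.-integrable [set: R] F.
  apply/integrableP; split; first exact: mF.
  under eq_integral do rewrite gee0_abs //.
  by rewrite integral_nneseries // => j; exact: L1w_measurable.
have := integrable_ae measurableT intF.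
apply: (@filterS _ _ (ae_filter_ringOfSetsType mu)) => x /= /(_ I) Ffin _.
have pull (v : nat -> R) : \sum_(0 <= j <oo) (`|v j| * w x)%:E =
    (w x)%:E * \sum_(0 <= j <oo) `|v j|%:E.
  by rewrite -nneseriesZl //; apply: eq_eseriesr => j _; rewrite mulrC.
have [->|wx] := eqVneq (w x) 0%R.
  by rewrite mulr0; apply: nneseries_ge0 => j _ _; rewrite mulr0.
rewrite (pull (fun j => u (j + n)%N x)) mulrC EFinM; apply: lee_wpmul2l.
  by rewrite lee_fin.
(* Here [w x > 0], so divergence of the series of [|u j x|] would make [F x] infinite. *)
apply: nneseries_posneg_tail; rewrite ltey; apply/eqP => uy.
by move: Ffin; rewrite /F pull uy gt0_muley // lte_fin lt_neqAle eq_sym wx w0.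
Qed.
End WeightedL1.

(** * Atoms *)

Section HardySpaces.
Context {R : realType} (w : R -> R) (dw : doubling_weight w).
Local Open Scope ereal_scope.
Notation mu := (@lebesgue_measure R).

Let w0 x : (0 <= w x)%R. Proof. by case: dw => w0 _ _ _; exact: w0. Qed.
Let mw := doubling_measurable dw.

Lemma L2w_norm_leE (a : R -> R) (Q : set R) : bounded_intervals Q ->
  (L2w_norm w a <= wmeas w Q `^ (- 2^-1)) =
  (\int[mu]_x (`|a x| ^+ 2 * w x)%:E <= (fine (wmeas w Q))^-1%:E).
Proof.
move=> bQ; rewrite /L2w_norm -{1}(fineK (wmeas_fin_num dw bQ)).
rewrite poweR_half_le //.
  by apply: integral_ge0 => x _; rewrite lee_fin mulr_ge0 ?exprn_ge0.
by rewrite fine_gt0 // (wmeas_gt0 dw bQ) (wmeas_lty dw bQ).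
Qed.

Lemma L2w_measurable (a : R -> R) (D : set R) : measurable_fun [set: R] a ->
  measurable_fun D (fun x => (`|a x| ^+ 2 * w x)%:E).
Proof.
move=> ma; apply/measurable_EFinP; apply: measurable_funTS.
apply: measurable_funM => //.
by apply: measurable_funX; exact: measurableT_comp.
Qed.

(* AM-GM: 2 |a| <= r |a|^2 + 1 / r on Q, with r := w(Q). *)
Lemma atom_L1 (a : R -> R) : atom w bounded_intervals a -> L1w_norm w a <= 1.
Proof.
move=> [ma [Q [bQ aQ + _]]]; rewrite L2w_norm_leE //.
have mQ := bounded_interval_measurable bQ.
have wQ := wmeas_gt0 dw bQ; have fQ := wmeas_fin_num dw bQ.
set r := fine _ => H.
have r0 : (0 < r)%R by rewrite fine_gt0 // wQ (wmeas_lty dw bQ).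
have -> : L1w_norm w a = \int[mu]_(x in Q) (`|a x| * w x)%:E.
  rewrite [RHS]integral_mkcond; apply: eq_integral => x _.
  rewrite patchE; case: ifPn => // /negP xQ.
  suff -> : a x = 0%R by rewrite normr0 mul0r.
  by apply/eqP/negPn/negP => ax; apply: xQ; rewrite inE; exact: aQ.
apply: (@le_trans _ _ (\int[mu]_(x in Q)
    ((r / 2)%:E * (`|a x| ^+ 2 * w x)%:E + (r^-1 / 2)%:E * (w x)%:E))).
  apply: ge0_le_integral => //.
  - by move=> x _; rewrite lee_fin mulr_ge0.
  - by apply: measurable_funTS; exact: L1w_measurable.
  - apply: emeasurable_funD; apply: measurable_funeM; first exact: L2w_measurable.
    by apply/measurable_EFinP; exact: measurable_funTS.
  move=> x _; rewrite -!EFinM -EFinD lee_fin mulrA -mulrDl ler_wpM2r //.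
  have : (0 <= r / 2 * (`|a x| - r^-1) ^+ 2)%R.
    by rewrite mulr_ge0 ?sqr_ge0 ?divr_ge0 ?ltW.
  have -> : (r / 2 * (`|a x| - r^-1) ^+ 2 =
      r / 2 * `|a x| ^+ 2 + r^-1 / 2 - `|a x|)%R.
    by field; rewrite gt_eqF.
  by rewrite subr_ge0.
have p0 x : 0 <= (`|a x| ^+ 2 * w x)%:E by rewrite lee_fin mulr_ge0 ?exprn_ge0.
have mL2 := @L2w_measurable a Q ma.
have mwQ : measurable_fun Q (EFin \o w).
  by apply/measurable_EFinP; exact: measurable_funTS.
have r20 : (0 <= r / 2)%R by rewrite divr_ge0 ?ltW.
have r'20 : (0 <= r^-1 / 2)%R by rewrite divr_ge0 ?invr_ge0 ?ltW.
rewrite ge0_integralD //; first last.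
- exact: measurable_funeM.
- by move=> x _; rewrite mule_ge0 ?lee_fin.
- exact: measurable_funeM.
- by move=> x _; rewrite mule_ge0 ?lee_fin // mulr_ge0 ?exprn_ge0.
rewrite !ge0_integralZl //; last by move=> x _; rewrite lee_fin.
have -> : \int[mu]_(x in Q) (w x)%:E = r%:E by rewrite /r fineK.
have HQ : \int[mu]_(x in Q) (`|a x| ^+ 2 * w x)%:E <= r^-1%:E.
  apply: le_trans H; apply: ge0_subset_integral => //; exact: L2w_measurable.
(* Each of the two products is [1 / 2]. *)
apply: (@le_trans _ _ ((r / 2)%:E * r^-1%:E + (r^-1 / 2)%:E * r%:E)).
  by rewrite leeD // lee_wpmul2l.
by rewrite -!EFinM -EFinD lee_fin le_eqVlt; apply/orP; left; apply/eqP;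
  field; rewrite gt_eqF.
Qed.

(** Serves as a placeholder, with coefficient 0, when the atoms of one series are distributed
    between two grids. *)
Lemma atom0 (G : set (set R)) (I : set R) : G I -> atom w G (cst 0%R).
Proof.
move=> GI; split; first exact: measurable_cst.
exists I; split => //.
- by move=> x /=; rewrite eqxx.
- rewrite /L2w_norm; under eq_integral do rewrite normr0 expr0n mul0r.
  by rewrite integral0 poweR0r ?invr_neq0 ?poweR_ge0.
- by under eq_integral do rewrite mul0r; rewrite integral0.
Qed.

Lemma atom_widen (G1 G2 : set (set R)) (a : R -> R) :
  G1 `<=` G2 -> atom w G1 a -> atom w G2 a.
Proof.
by move=> G12 [ma [Q [GQ ? ? ?]]]; split => //; exists Q; split => //; exact: G12.
Qed.

(* The sharp factor is K^(-1/2); (1 + K)^-1 is smaller and avoids a root. *)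
Lemma atom_shrink (G : set (set R)) (a : R -> R) (Q I : set R) (K : R) :
  measurable_fun [set: R] a -> bounded_intervals Q -> bounded_intervals I -> G I ->
  [set x | a x != 0%R] `<=` Q -> L2w_norm w a <= wmeas w Q `^ (- 2^-1) ->
  \int[mu]_x (a x * w x)%:E = 0 ->
  Q `<=` I -> (0 < K)%R -> wmeas w I <= K%:E * wmeas w Q ->
  atom w G (fun x => (1 + K)^-1 * a x)%R.
Proof.
move=> ma bQ bI GI aQ aL2 a0 QI K0 IQ.
have K1p : (0 < 1 + K)%R by rewrite addr_gt0.
have K1 : (0 < (1 + K)^-1)%R by rewrite invr_gt0.
split; first exact: measurable_funM.
exists I; split => //.
- by move=> x /=; rewrite mulf_eq0 negb_or => /andP[_ /aQ/QI].
- rewrite L2w_norm_leE //; move: aL2; rewrite L2w_norm_leE //.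
  have -> : \int[mu]_x (`|(1 + K)^-1 * a x| ^+ 2 * w x)%:E =
      ((1 + K)^-1 ^+ 2)%:E * \int[mu]_x (`|a x| ^+ 2 * w x)%:E.
    rewrite -ge0_integralZl //.
    + apply: eq_integral => x _.
      by rewrite normrM exprMn ger0_norm ?ltW // -mulrA EFinM.
    + exact: L2w_measurable.
    + by move=> x _; rewrite lee_fin mulr_ge0 ?exprn_ge0.
    + by rewrite lee_fin exprn_ge0 // ltW.
  move=> /(lee_wpmul2l (x := ((1 + K)^-1 ^+ 2)%:E)) H.
  apply: le_trans (H _) _; first by rewrite lee_fin exprn_ge0 // ltW.
  have [fQ fI] := (wmeas_fin_num dw bQ, wmeas_fin_num dw bI).
  move: IQ; rewrite -(fineK fQ) -(fineK fI) /= -EFinM lee_fin -EFinM lee_fin.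
  have : (0 < fine (wmeas w Q))%R.
    by rewrite fine_gt0 // (wmeas_gt0 dw bQ) (wmeas_lty dw bQ).
  have : (0 < fine (wmeas w I))%R.
    by rewrite fine_gt0 // (wmeas_gt0 dw bI) (wmeas_lty dw bI).
  move: (fine _) (fine _) => i q i0 q0 iq.
  (* What remains is [i <= (1 + K)^2 q], which follows from [i <= K q]. *)
  rewrite exprVn -invfM lef_pV2 ?posrE ?mulr_gt0 ?exprn_gt0 //.
  apply: le_trans iq _; rewrite ler_pM2r //; nra.
(* Pulling the constant out of the cancellation integral requires integrability of [a w], which the
   bound 1 on the weighted L1 norm of an atom supplies. *)
- have int_aw : mu.-integrable [set: R] (fun x => (a x * w x)%:E).
    apply/integrableP; split.
      by apply/measurable_EFinP; exact: measurable_funM.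
    apply: (@le_lt_trans _ _ 1); last exact: (ltry (1%R : R)).
    apply: le_trans (atom_L1 (a := a) _); last by split => //; exists Q; split.
    rewrite /L1w_norm le_eqVlt; apply/orP; left; apply/eqP.
    by apply: eq_integral => x _; rewrite /= normrM (ger0_norm (w0 x)).
  under eq_integral do rewrite -mulrA EFinM.
  by rewrite integralZl // a0 mule0.
Qed.

Lemma atom_dyadic_or_shifted (delta : R) :
  (0 < delta < 1)%R -> far_from_dyadic delta ->
  exists2 c : R, (0 < c)%R & forall a, atom w bounded_intervals a ->
    atom w dyadic (fun x => c^-1 * a x)%R \/
    atom w (shifted_dyadic delta) (fun x => c^-1 * a x)%R.
Proof.
move=> d01 far; have [K K0 cover] := dyadic_or_shifted_superset dw d01 far.
exists (1 + K)%R; first by lra.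
move=> a [ma [Q [bQ aQ aL2 a0]]].
have [I [QI GI IQ]] := cover Q bQ.
case: GI => GI; [left|right].
  by apply: (atom_shrink (Q := Q) (I := I)) => //; exact: dyadic_bounded.
by apply: (atom_shrink (Q := Q) (I := I)) => //; exact: shifted_dyadic_bounded GI.
Qed.

End HardySpaces.

(** * Atomic decompositions *)

Section AtomicDecompositions.
Context {R : realType} (w : R -> R) (dw : doubling_weight w).
Local Open Scope ereal_scope.
Notation mu := (@lebesgue_measure R).

Let w0 x : (0 <= w x)%R. Proof. by case: dw => w0 _ _ _; exact: w0. Qed.
Let mw := doubling_measurable dw.

Lemma L1w_triangleB (f g h : R -> R) : measurable_fun [set: R] f ->
  measurable_fun [set: R] g -> measurable_fun [set: R] h ->
  (forall x, f x = g x - h x)%R ->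
  L1w_norm w f <= L1w_norm w g + L1w_norm w h.
Proof.
move=> mf mg mh E.
have -> : L1w_norm w h = L1w_norm w (fun x => - h x)%R.
  by apply: eq_integral => x _; rewrite normrN.
apply: L1w_triangle => //; first exact: measurableT_comp.
by apply: aeW => x _; rewrite E.
Qed.

Lemma atom_combination_measurable (G : set (set R)) (lam : nat -> R)
    (a : nat -> R -> R) (n : nat) : (forall j, atom w G (a j)) ->
  measurable_fun [set: R] (fun x => \sum_(0 <= j < n) lam j * a j x)%R.
Proof.
move=> Ga; apply: measurable_sum => j; apply: measurable_funM => //.
by case: (Ga j).
Qed.

(** Each rescaled atom goes to [G1] if it is a [G1]-atom and to [G2] otherwise, and its coefficient
    is multiplied by [c]. Zero atoms fill the gaps, so both new series keep the original
    indexing. *)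
Lemma atomic_rep_split (G1 G2 : set (set R)) (I1 I2 : set R) (c : R)
    (f : R -> R) (lam : nat -> R) (a : nat -> R -> R) :
  G1 I1 -> G2 I2 -> G1 `<=` bounded_intervals -> (0 < c)%R ->
  (forall b, atom w bounded_intervals b ->
     atom w G1 (fun x => c^-1 * b x)%R \/ atom w G2 (fun x => c^-1 * b x)%R) ->
  measurable_fun [set: R] f -> atomic_rep w bounded_intervals f lam a ->
  exists (g h : R -> R) (l1 : nat -> R) (a1 : nat -> R -> R) (l2 : nat -> R)
      (a2 : nat -> R -> R),
    [/\ [/\ measurable_fun [set: R] g, measurable_fun [set: R] h &
          forall x, f x = g x + h x]%R,
        atomic_rep w G1 g l1 a1, atomic_rep w G2 h l2 a2,
        \sum_(0 <= j <oo) `|l1 j|%:E <= c%:E * \sum_(0 <= j <oo) `|lam j|%:E &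
        \sum_(0 <= j <oo) `|l2 j|%:E <= c%:E * \sum_(0 <= j <oo) `|lam j|%:E].
Proof.
move=> GI1 GI2 bG1 c0 dicho mf [aa lamoo fcvg].
pose A j := `[< atom w G1 (fun x => c^-1 * a j x)%R >].
pose l1 j := (if A j then c * lam j else 0)%R.
pose a1 j := if A j then (fun x => c^-1 * a j x)%R else cst 0%R.
pose l2 j := (if A j then 0 else c * lam j)%R.
pose a2 j := if A j then cst 0%R else (fun x => c^-1 * a j x)%R.
have aa1 j : atom w G1 (a1 j).
  by rewrite /a1 /A; case: asboolP => // _; exact: atom0 GI1.
have aa2 j : atom w G2 (a2 j).
  rewrite /a2 /A; case: asboolP => // [_|nA]; first exact: atom0 GI2.
  by case: (dicho _ (aa j)).
have split_term j x : (lam j * a j x = l1 j * a1 j x + l2 j * a2 j x)%R.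
  rewrite /l1 /a1 /l2 /a2; case: (A j); rewrite /= ?mul0r ?add0r ?addr0;
    by rewrite mulrACA divff ?mul1r ?gt_eqF.
have coef_le (l : nat -> R) : (forall j, `|l j| <= c * `|lam j|)%R ->
    \sum_(0 <= j <oo) `|l j|%:E <= c%:E * \sum_(0 <= j <oo) `|lam j|%:E.
  move=> ll; rewrite -nneseriesZl //; apply: lee_nneseries => [j _ _|j _].
    by rewrite lee_fin.
  by rewrite -EFinM lee_fin.
have l1c : \sum_(0 <= j <oo) `|l1 j|%:E <= c%:E * \sum_(0 <= j <oo) `|lam j|%:E.
  apply: coef_le => j; rewrite /l1; case: (A j).
    by rewrite normrM gtr0_norm.
  by rewrite normr0 mulr_ge0 // ltW.
have l2c : \sum_(0 <= j <oo) `|l2 j|%:E <= c%:E * \sum_(0 <= j <oo) `|lam j|%:E.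
  apply: coef_le => j; rewrite /l2; case: (A j).
    by rewrite normr0 mulr_ge0 // ltW.
  by rewrite normrM gtr0_norm.
have coo : c%:E * \sum_(0 <= j <oo) `|lam j|%:E < +oo.
  have fl : \sum_(0 <= j <oo) `|lam j|%:E \is a fin_num.
    by rewrite ge0_fin_numE //; apply: nneseries_ge0 => j _ _; rewrite lee_fin.
  by rewrite -(fineK fl) -EFinM ltry.
(* Atoms have weighted L1 norm at most 1, so the norms of the terms sum to at most [c] times the sum
   of the [|lam j|]. *)
have [|| g mg gcvg] := @L1w_series_complete R w w0 mw (fun j x => l1 j * a1 j x)%R.
- by move=> j; apply: measurable_funM => //; case: (aa1 j).
- apply: le_lt_trans (le_lt_trans l1c coo); apply: lee_nneseries => [j _ _|j _].
    exact: L1w_norm_ge0.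
  rewrite L1w_normZ //; last by case: (aa1 j).
  rewrite -[leRHS]mule1; apply: lee_wpmul2l; first by rewrite lee_fin.
  by apply: atom_L1 => //; exact: atom_widen (aa1 j).
have mh : measurable_fun [set: R] (fun x => f x - g x)%R by exact: measurable_funB.
(* Taking [f - g] as second part makes the decomposition exact at every point. *)
exists g, (fun x => f x - g x)%R, l1, a1, l2, a2; split => //.
- by split => // x; rewrite addrC subrK.
- by split => //; exact: le_lt_trans coo.
split => //; first exact: le_lt_trans coo.
have mS1 n := @atom_combination_measurable G1 l1 a1 n aa1.
have mS2 n := @atom_combination_measurable G2 l2 a2 n aa2.
have mS n := @atom_combination_measurable bounded_intervals lam a n aa.
(* The error of the second series is the error for [f] minus the error for [g], because the partial
   sums over the two grids add up to the original one. *)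
apply: (L1w_cvg0_le w0 (s := fun n =>
  L1w_norm w (fun x => f x - \sum_(0 <= j < n) lam j * a j x)%R +
  L1w_norm w (fun x => g x - \sum_(0 <= j < n) l1 j * a1 j x)%R)).
  move=> n; apply: L1w_triangleB; try exact: measurable_funB.
  move=> x; under [in RHS]eq_bigr do rewrite split_term.
  by rewrite big_split /=; ring.
by rewrite -[X in _ --> X]adde0; apply: cvgeD.
Qed.

(** The two series are interleaved. The first [n] terms consist of [uphalf n] terms for [g] and
    [n./2] terms for [h], and both numbers tend to infinity. *)
Lemma atomic_rep_merge (G1 G2 : set (set R)) (f g h : R -> R)
    (l m : nat -> R) (a b : nat -> R -> R) :
  G1 `<=` bounded_intervals -> G2 `<=` bounded_intervals ->
  measurable_fun [set: R] f -> measurable_fun [set: R] g ->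
  measurable_fun [set: R] h -> ae_eqw w f (fun x => g x + h x)%R ->
  atomic_rep w G1 g l a -> atomic_rep w G2 h m b ->
  exists lam e, atomic_rep w bounded_intervals f lam e /\
    \sum_(0 <= j <oo) `|lam j|%:E <=
      \sum_(0 <= j <oo) `|l j|%:E + \sum_(0 <= j <oo) `|m j|%:E.
Proof.
move=> bG1 bG2 mf mg mh fgh [aa loo gcvg] [bb moo hcvg].
pose lam j := if odd j then m j./2 else l j./2.
pose e j := if odd j then b j./2 else a j./2.
have lam_le : \sum_(0 <= j <oo) `|lam j|%:E <=
      \sum_(0 <= j <oo) `|l j|%:E + \sum_(0 <= j <oo) `|m j|%:E.
  apply: lime_le; first by apply: is_cvg_nneseries => j _ _; rewrite lee_fin.
  apply: nearW => n /=.
  rewrite (eq_bigr (fun j => if odd j then `|m j./2|%:E else `|l j./2|%:E)); last first.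
    by move=> j _; rewrite /lam; case: odd.
  rewrite (sum_interleave (fun j => `|l j|%:E) (fun j => `|m j|%:E)).
  by rewrite leeD // nneseries_lim_ge // => j _ _; rewrite lee_fin.
exists lam, e; split => //; split.
- move=> j; rewrite /e; case: odd; first exact: atom_widen (bb _).
  exact: atom_widen (aa _).
- by apply: le_lt_trans lam_le _; rewrite lte_add_pinfty.
have mA n := @atom_combination_measurable G1 l a n aa.
have mB n := @atom_combination_measurable G2 m b n bb.
have sumE n x : (\sum_(0 <= j < n) lam j * e j x =
    \sum_(0 <= j < uphalf n) l j * a j x + \sum_(0 <= j < n./2) m j * b j x)%R.
  rewrite -(sum_interleave (fun j => l j * a j x)%R (fun j => m j * b j x)%R).
  by apply: eq_bigr => j _; rewrite /lam /e; case: odd.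
apply: (L1w_cvg0_le w0 (s := fun n =>
  L1w_norm w (fun x => g x - \sum_(0 <= j < uphalf n) l j * a j x)%R +
  L1w_norm w (fun x => h x - \sum_(0 <= j < n./2) m j * b j x)%R)).
  move=> n; apply: L1w_triangle => //; try exact: measurable_funB.
    under eq_fun do rewrite sumE.
    by apply: measurable_funB => //; exact: measurable_funD.
  move: fgh; apply: (@filterS _ _ (ae_filter_ringOfSetsType mu)) => x /= fgh wx.
  by rewrite fgh // sumE; ring.
rewrite -[X in _ --> X]adde0; apply: cvgeD => //.
  (* [uphalf n >= N] as soon as [n >= 2 N]. *)
  apply: (cvg_comp uphalf (fun n => L1w_norm w
    (fun x => g x - \sum_(0 <= j < n) l j * a j x)%R)) gcvg => S [N _ NS].
  by exists N.*2 => // n /= Nn; apply: NS => /=; lia.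
apply: (cvg_comp half (fun n => L1w_norm w
  (fun x => h x - \sum_(0 <= j < n) m j * b j x)%R)) hcvg => S [N _ NS].
by exists N.*2 => // n /= Nn; apply: NS => /=; lia.
Qed.

(** * Comparison of the atomic norms *)

Lemma H1_norm_ge0 (G : set (set R)) (f : R -> R) : 0 <= H1_norm w G f.
Proof.
apply: le_ereal_inf_tmp => _ [l [b [_ ->]]].
by apply: nneseries_ge0 => j _ _; rewrite lee_fin.
Qed.

Lemma H1_norm_fin_num (G : set (set R)) (f : R -> R) :
  H1 w G f -> H1_norm w G f \is a fin_num.
Proof.
move=> [_ [lam [a rep]]]; rewrite ge0_fin_numE ?H1_norm_ge0 //.
case: (rep) => _ + _; apply: le_lt_trans.
by apply: ereal_inf_lbound; exists lam, a.
Qed.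

(** Any representations of [g] and [h] merge into one of [f] whose cost is at most the sum of
    theirs; the infima are then taken independently. *)
Lemma H1_of_sum (G1 G2 : set (set R)) (f g h : R -> R) :
  G1 `<=` bounded_intervals -> G2 `<=` bounded_intervals ->
  measurable_fun [set: R] f -> H1 w G1 g -> H1 w G2 h ->
  ae_eqw w f (fun x => g x + h x)%R ->
  H1 w bounded_intervals f /\
  H1_norm w bounded_intervals f <= H1_norm w G1 g + H1_norm w G2 h.
Proof.
move=> bG1 bG2 mf H1g H1h fgh.
have merge l m a b := @atomic_rep_merge G1 G2 f g h l m a b bG1 bG2 mf H1g.1 H1h.1 fgh.
split.
  case: H1g H1h merge => [_ [l [a ga]]] [_ [m [b hb]]] merge.
  by have [lam [e [rep _]]] := merge _ _ _ _ ga hb; split => //; exists lam, e.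
apply: ereal_infD_ge; [exact: H1_norm_fin_num|exact: H1_norm_fin_num|].
move=> _ _ [l [a [ga ->]]] [m [b [hb ->]]].
have [lam [e [rep]]] := merge _ _ _ _ ga hb; apply: le_trans.
by apply: ereal_inf_lbound; exists lam, e.
Qed.

(** Stated for a single representation, it gives both the inclusion of the spaces and, by taking
    infima, the norm bound. *)
Lemma H1_sum_of_rep (delta : R) : (0 < delta < 1)%R -> far_from_dyadic delta ->
  exists2 C : R, (0 < C)%R & forall f lam a, measurable_fun [set: R] f ->
    atomic_rep w bounded_intervals f lam a ->
    H1_sum w dyadic (shifted_dyadic delta) f /\
    H1_sum_norm w dyadic (shifted_dyadic delta) f <=
      C%:E * \sum_(0 <= j <oo) `|lam j|%:E.
Proof.
move=> d01 far; have [c c0 dicho] := atom_dyadic_or_shifted dw d01 far.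
exists (c + c)%R; first exact: addr_gt0.
move=> f lam a mf rep.
(* The generation 0 intervals with [k = 0] support the zero atoms of each grid. *)
have [g [h [l1 [a1 [l2 [a2 [[mg mh fgh] rep1 rep2 le1 le2]]]]]]] :=
  atomic_rep_split (dyadic_fine R 0 0) (shifted_dyadic_fine delta 0 0)
    (@dyadic_bounded R) c0 dicho mf rep.
have H1g : H1 w dyadic g by split => //; exists l1, a1.
have H1h : H1 w (shifted_dyadic delta) h by split => //; exists l2, a2.
have fgh_ae : ae_eqw w f (fun x => g x + h x)%R by apply: aeW => x _; exact: fgh.
split; first by split => //; exists g, h.
apply: (@le_trans _ _ (H1_norm w dyadic g + H1_norm w (shifted_dyadic delta) h)).
  by apply: ereal_inf_lbound; exists g, h.
rewrite EFinD ge0_muleDl ?lee_fin ?(ltW c0) //.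
apply: leeD.
  by apply: le_trans le1; apply: ereal_inf_lbound; exists l1, a1.
by apply: le_trans le2; apply: ereal_inf_lbound; exists l2, a2.
Qed.


End AtomicDecompositions.

Theorem corollary6p2 (R : realType) (delta : R) (w : R -> R)
    (delta01 : 0 < delta < 1) (far : far_from_dyadic delta)
    (dw : doubling_weight w) :
  (H1 w bounded_intervals = H1_sum w dyadic (shifted_dyadic delta) /\
   exists2 C : R, 0 < C &
     forall f : R -> R, H1 w bounded_intervals f ->
       (H1_norm w bounded_intervals f <=
          C%:E * H1_sum_norm w dyadic (shifted_dyadic delta) f)%E /\
       (H1_sum_norm w dyadic (shifted_dyadic delta) f <=
          C%:E * H1_norm w bounded_intervals f)%E) /\
  (exists2 C : R, 0 < C &
     forall f : R -> R, locally_integrable [set: R] f ->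
       forall x : R,
         (weighted_maximal w bounded_intervals f x <=
            C%:E * (weighted_maximal w dyadic f x +
                    weighted_maximal w (shifted_dyadic delta) f x))%E /\
         (weighted_maximal w dyadic f x +
          weighted_maximal w (shifted_dyadic delta) f x <=
            C%:E * weighted_maximal w bounded_intervals f x)%E).
Proof.
have bd := @dyadic_bounded R; have bs := @shifted_dyadic_bounded R delta.
split; last first.
  have [C C0 H] := maximal_equivalence dw delta01 far.
  by exists C => // f [mf _ _] x; exact: H.
have [C C0 H] := H1_sum_of_rep dw delta01 far.
split.
  apply/seteqP; split => f.
    by move=> [mf [lam [a rep]]]; have [] := H f lam a mf rep.
  by move=> [mf [g [h [H1g H1h fgh]]]]; have [] := H1_of_sum dw bd bs mf H1g H1h fgh.
have C1 : 0 < 1 + C by rewrite addr_gt0.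
(* Merging costs a factor 1 and splitting a factor [C]; [1 + C] serves for both. *)
exists (1 + C) => // f [mf [lam [a rep]]]; split.
  (* Once the positive constant is moved to the left, the claim is a lower bound for an infimum and
     is checked on each decomposition. *)
  rewrite muleC -lee_pdivrMr //; apply: le_ereal_inf_tmp => _ [g [h [H1g H1h fgh ->]]].
  rewrite lee_pdivrMr //.
  have [_ Hle] := H1_of_sum dw bd bs mf H1g H1h fgh; apply: le_trans Hle _.
  rewrite -[leLHS]mule1; apply: lee_wpmul2l.
    by rewrite adde_ge0 ?H1_norm_ge0.
  by rewrite lee_fin lerDl ltW.
rewrite muleC -lee_pdivrMr //; apply: le_ereal_inf_tmp => _ [l [b [repb ->]]].
rewrite lee_pdivrMr // muleC.
have [_ Hle] := H f l b mf repb; apply: le_trans Hle _.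
apply: lee_wpmul2r; last by rewrite lee_fin lerDr.
by apply: nneseries_ge0 => j _ _; rewrite lee_fin.
Qed.
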